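(* Let $\mathcal{S}=\{S_1,\dots,S_m\}$ be a system of injective contraction maps in a complete metric space $X$ which possesses the finite intersection property, and let $K$ be its attractor. Then $K$ is a dendrite if and only if the intersection graph $\Gamma(\mathcal{S})$ of the system $\mathcal{S}$ is a tree.
   Context: The attractor of $\mathcal{S}=\{S_1,\dots,S_m\}$ is the unique nonempty compact set $K\subset X$ with $K=\bigcup_{i=1}^m S_i(K)$. Let $I=\{1,\dots,m\}$ and $K_i=S_i(K)$ (the pieces of $K$). The system $\mathcal{S}$ possesses the finite intersection property if $K_i\cap K_j$ is finite for all $i\ne j$ in $I$. Intersection graph: let $P=\bigcup_{i\neq j}(K_i\cap K_j)$. Then $\Gamma(\mathcal{S})$ is the (finite) bipartite graph whose vertices are the pieces $K_i$, $i\in I$ (''white'' vertices, one for each index $i$) and the points $p\in P$ (''black'' vertices), with an edge $\{K_i,p\}$ if and only if $p\in K_i$. A tree is a connected graph without cycles. A dendrite is a locally connected continuum (nonempty compact connected metric space) containing no simple closed curve; a single point is allowed as a degenerate dendrite. *)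

(* Defs.v *)
From HB Require Import structures.
From mathcomp Require Import all_boot all_order all_algebra.
From mathcomp Require Import all_classical all_reals all_analysis.

Set Implicit Arguments.
Unset Strict Implicit.
Unset Printing Implicit Defensive.

Import Order.TTheory GRing.Theory Num.Theory.
Import numFieldNormedType.Exports.

Local Open Scope classical_set_scope.
Local Open Scope ring_scope.

#[short(type="completeMetricType")]
HB.structure Definition CompleteMetric (R : numDomainType) :=
  { M of Metric R M & Complete M }.

(* The library's [is_contraction] is restricted to normed modules. *)
Definition metric_contraction (R : realType) (X : metricType R) (f : X -> X) :=
  exists q : R, [/\ 0 <= q, q < 1 &
    forall x y, mdist (f x) (f y) <= q * mdist x y].

Section Dendrites.
Context {R : realType} {X : metricType R}.
Implicit Types K C V : set X.

Definition locally_connected K :=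
  forall x U, K x -> open U -> U x ->
    exists V, [/\ V x, V `<=` U, connected V &
      exists2 W, open W & V = K `&` W].

Definition simple_closed_curve C :=
  exists gamma : R -> X,
    [/\ {within `[0, 1], continuous gamma},
        gamma 0 = gamma 1,
        {in `[0, 1[ &, injective gamma} &
        gamma @` `[0, 1] = C].

Definition dendrite K :=
  [/\ K !=set0, compact K, connected K, locally_connected K &
      ~ exists2 C, simple_closed_curve C & C `<=` K].

End Dendrites.

Section Trees.
Context {V : eqType}.
Implicit Type e : rel V.

Definition graph_connected e :=
  forall u v, exists2 p, path e u p & last u p = v.

(* In a simple undirected graph a cycle has at least three vertices. *)
Definition graph_acyclic e :=
  forall c : seq V, (2 < size c)%N -> ~ ucycle e c.

Definition tree e := graph_connected e /\ graph_acyclic e.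

End Trees.

Section IteratedFunctionSystems.
Context {R : realType} {X : metricType R} {m : nat}.
Variables (S : 'I_m -> X -> X) (K : set X).

Definition piece (i : 'I_m) : set X := S i @` K.

Definition is_attractor :=
  [/\ K !=set0, compact K & K = \bigcup_i piece i].

Definition finite_intersection_property :=
  forall i j, i != j -> finite_set (piece i `&` piece j).

Definition common_points : set X :=
  [set p | exists i j, [/\ i != j, piece i p & piece j p]].

(* Equal pieces with distinct indices are distinct white vertices [inl i];
   the black vertices [inr p] are the elements of the set [common_points]. *)
Definition intersection_graph : rel ('I_m + common_points) :=
  fun u v => match u, v with
  | inl i, inr p | inr p, inl i => \val p \in piece i
  | _, _ => false
  end.

End IteratedFunctionSystems.

Arguments intersection_graph {R X m} S K u v.

(* Main.v *)
Require Import Defs.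
From HB Require Import structures.
From mathcomp Require Import all_boot all_order all_algebra.
From mathcomp Require Import all_classical all_reals all_analysis.
From mathcomp Require Import lra.

(** If the intersection graph is connected, any two points of [K] are joined by
    finitely many pieces, their number being bounded uniformly; substituting such
    chains into themselves gives Hölder paths, so [K] is path connected, and then
    locally connected because the cells [S_w (K)] are small continua.

    In a tree, two points of [K] outside [P] lying in different pieces are
    separated in [K] by a point of [P].  A simple closed curve is not disconnected
    by a point, hence lies in a single piece; pulling it back by [S_i] again and
    again shows that its diameter is 0.

    Conversely, a cycle of the graph through a black vertex [p] and the next black
    vertex [p1], with [K_i0] between them, yields a path from [p1] to [p] inside
    [K_i0] and another one inside the other pieces.  Collapsing a maximal family of
    loops (Zorn) shrinks each path to an arc; the two arcs meet in a finite set, so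
    their union contains a simple closed curve. *)

Set Implicit Arguments.
Unset Strict Implicit.
Unset Printing Implicit Defensive.

Import Order.TTheory GRing.Theory Num.Theory.
Import numFieldNormedType.Exports.

Local Open Scope classical_set_scope.
Local Open Scope ring_scope.

(** * Uniformly continuous paths *)

(** Where [u] is positive, [u y < d] fails on a neighbourhood once [d] is small; elsewhere [v y < e]
    persists nearby. Compactness makes [d] uniform. This later yields the continuity of inverse
    maps. *)
Lemma compact_modulus (R : realType) (T : topologicalType) (A : set T)
    (u v : T -> R) :
  compact A -> continuous u -> continuous v ->
  (forall y, A y -> u y <= 0 -> v y <= 0) ->
  forall e, 0 < e -> exists2 d, 0 < d & forall y, A y -> u y < d -> v y < e.
Proof.
move=> cA cu cv uv e e0.
have /compact_near_coveringP/(_ R (0:R)^'+ (fun d y => u y < d -> v y < e)) := cA.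
case => [y Ay|]; last first.
  move=> d /= d0 H; exists (d / 2); first by rewrite divr_gt0.
  by move=> y Ay; apply: H => //=; rewrite /ball_ /= ?sub0r ?normrN ?gtr0_norm; lra.
have [uy0|uy0] := leP (u y) 0.
  have vy : v y < e by rewrite (le_lt_trans _ e0)// uv.
  exists ([set z | v z < e], setT) => /=; last by case=> z d /= [].
  split; last exact: filterT.
  exact: (cv y _ (lt_nbhsl vy)).
exists ([set z | u y / 2 < u z], [set d | d < u y / 2]) => /=.
  split.
    have uy2 : u y / 2 < u y by lra.
    exact: (cu y _ (lt_nbhsr uy2)).
  by apply: nbhs_right_lt; lra.
by case=> z d /= [H1 H2 H3]; lra.
Qed.

Section Clamp.
Context {R : realType}.
Implicit Types s t : R.

(** Retraction of the line onto [[0, 1]]: it extends a map controlled only there to a path on all of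
    [R]. *)
Definition clamp t : R := Num.max 0 (Num.min 1 t).

Lemma clamp_itv t : 0 <= clamp t <= 1.
Proof. by rewrite /clamp le_max lexx ge_max ler01 ge_min lexx. Qed.

Lemma clamp_id t : 0 <= t -> t <= 1 -> clamp t = t.
Proof. by move=> t0 t1; rewrite /clamp (min_r t1) max_r. Qed.

Lemma clamp_le s t : s <= t -> clamp s <= clamp t <= clamp s + (t - s).
Proof.
move=> st; rewrite /clamp; case: (leP 1 s) => ?; case: (leP 1 t) => ?;
by try case: (leP 0 s) => ?; try case: (leP 0 t) => ?; rewrite ?maxEle ?ler01; lra.
Qed.

Lemma clamp_dist s t : `|clamp s - clamp t| <= `|s - t|.
Proof.
wlog st : s t / s <= t.
  by move=> H; have [/H//|/ltW/H] := leP s t; rewrite distrC (distrC t).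
have /andP[? ?] := clamp_le st.
by rewrite distrC (distrC s) !ger0_norm; lra.
Qed.

End Clamp.

Section Paths.
Context {R : realType} {X : metricType R}.
Implicit Types (f g : R -> X) (A B K : set X).

Lemma mdist_quad (x y z w : X) :
  `|mdist x y - mdist z w| <= mdist x z + mdist y w.
Proof.
have := metric_triangle x z y; have := metric_triangle z w y.
have := metric_triangle z x w; have := metric_triangle x y w.
rewrite (metric_sym w y) (metric_sym z x) ler_norml => *.
by apply/andP; split; lra.
Qed.

Lemma continuous_mdist (T : topologicalType) (h k : T -> X) :
  continuous h -> continuous k -> continuous (fun t => mdist (h t) (k t)).
Proof.
move=> ch ck t; apply/cvgrPdist_lt => e e0.
have e20 : 0 < e / 2 by lra.
have := ch t => /metricType_numDomainType.cvgrPdist_lt/(_ _ e20) ht.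
have := ck t => /metricType_numDomainType.cvgrPdist_lt/(_ _ e20) kt.
near=> s; rewrite (le_lt_trans (mdist_quad _ _ _ _))// [e]splitr ltrD//.
- by near: s.
- by near: s.
Unshelve. all: by end_near. Qed.

Lemma compact_mdist_bounded K : compact K ->
  exists2 D, 0 < D & forall x y, K x -> K y -> mdist x y <= D.
Proof.
move=> cK; have [[x0 Kx0]|K0] := pselect (K !=set0); last first.
  by exists 1 => // x y Kx; case: K0; exists x.
have : compact (mdist x0 @` K).
  apply: continuous_compact => //; apply: continuous_subspaceT.
  by apply: continuous_mdist => z; [exact: cvg_cst|exact: cvg_id].
move=> /compact_bounded[M [_ HM]].
have {}HM x : K x -> mdist x0 x <= `|M| + 1.
  move=> Kx; apply: le_trans (ler_norm _) _.
  by apply: HM; [have := ler_norm M; lra | exists x].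
exists (2 * (`|M| + 1)); first by have := normr_ge0 M; lra.
move=> x y Kx Ky; have := HM _ Kx; have := HM _ Ky.
by have := metric_triangle x x0 y; rewrite (metric_sym x x0); lra.
Qed.

(** Paths are uniformly continuous on the whole line, so pasting and affine changes of parameter
    carry no domain condition. *)
Definition ucont f := forall e, 0 < e ->
  exists2 d, 0 < d & forall s t, `|s - t| < d -> mdist (f s) (f t) < e.

Lemma ucont_continuous f : ucont f -> continuous f.
Proof.
move=> uf t; apply/metricType_numDomainType.cvgrPdist_lt => e /uf[d d0 H].
near=> s; apply: H; near: s; exact: cvgr_dist_lt.
Unshelve. all: by end_near. Qed.

Definition joined A x y :=
  exists f, [/\ ucont f, f 0 = x, f 1 = y & forall t, A (f t)].

Lemma joinedS A B x y : A `<=` B -> joined A x y -> joined B x y.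
Proof. by move=> AB [f [uf f0 f1 Af]]; exists f; split => // t; exact: AB. Qed.

Definition paste (c : R) f g : R -> X := fun t => if t <= c then f t else g t.

Lemma ucont_paste c f g : ucont f -> ucont g -> f c = g c ->
  ucont (paste c f g).
Proof.
move=> uf ug fg e e0.
have e20 : 0 < e / 2 by lra.
have e2e : e / 2 < e by lra.
have [d d0 Hf] := uf _ e20; have [d' d'0 Hg] := ug _ e20.
exists (Num.min d d'); first by rewrite lt_min d0.
(* A step across [c] is cut at [c] into two steps costing less than [e / 2] each. *)
have key s t : s <= c -> c < t -> `|s - t| < Num.min d d' ->
    mdist (f s) (g t) < e.
  move=> sc ct; rewrite lt_min => /andP[st st'].
  have := metric_triangle (f s) (f c) (g t); rewrite {2}fg.
  have := Hf s c; have := Hg c t.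
  have : `|s - t| = t - s by rewrite ler0_norm; lra.
  have -> : `|s - c| = c - s by rewrite ler0_norm; lra.
  have -> : `|c - t| = t - c by rewrite ler0_norm; lra.
  move=> E Ht Hs.
  have : mdist (g c) (g t) < e / 2 by apply: Ht; lra.
  have : mdist (f s) (f c) < e / 2 by apply: Hs; lra.
  by lra.
move=> s t; rewrite /paste; case: (leP s c) => sc; case: (leP t c) => tc.
- by rewrite lt_min => /andP[/Hf /lt_trans-> //].
- exact: key.
- by rewrite distrC metric_sym; exact: key.
- by rewrite lt_min => /andP[_ /Hg /lt_trans->].
Qed.

Lemma ucont_affine (a b : R) f : ucont f -> ucont (fun t => f (a * t + b)).
Proof.
move=> uf e /uf[d d0 H]; exists (d / (`|a| + 1)).
  by rewrite divr_gt0//; have := normr_ge0 a; lra.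
move=> s t; rewrite ltr_pdivlMr; last by have := normr_ge0 a; lra.
move=> st; apply: H.
have -> : a * s + b - (a * t + b) = a * (s - t) by lra.
rewrite normrM; have := normr_ge0 (s - t); lra.
Qed.

Lemma joined_trans A x y z : joined A x y -> joined A y z -> joined A x z.
Proof.
move=> [f [uf f0 f1 Af]] [g [ug g0 g1 Ag]].
exists (paste (1 / 2) (fun t => f (2 * t + 0)) (fun t => g (2 * t + (- 1)))).
split.
- apply: ucont_paste; [exact: ucont_affine|exact: ucont_affine|].
  have -> : 2 * (1 / 2) + 0 = 1 :> R by lra.
  have -> : 2 * (1 / 2) + (- 1) = 0 :> R by lra.
  by rewrite f1 g0.
- have h0 : 0 <= 1 / 2 :> R by lra.
  by rewrite /paste h0 mulr0 addr0.
- have h1 : (1 <= 1 / 2 :> R) = false by apply/negbTE; rewrite -ltNge; lra.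
  have h2 : 2 * 1 + (- 1) = 1 :> R by lra.
  by rewrite /paste h1 h2.
- by move=> t; rewrite /paste; case: ifP.
Qed.

End Paths.

(** * Path connectedness of a self-similar set *)

Section Hata.
Context {R : realType} {X : metricType R}.
Implicit Types (f g : R -> X).

(* The sharper constant [c] at the two ends is what makes [tame] stable under
   concatenation: a step across the junction costs [c + c]. *)
Definition tame (d c l : R) f :=
  [/\ forall s : R, 0 <= s -> s <= l -> s <= d -> mdist (f 0) (f s) <= c,
      forall s : R, 0 <= s -> s <= l -> l - s <= d -> mdist (f s) (f l) <= c &
      forall s t : R, 0 <= s -> s <= t -> t <= l -> t - s <= d ->
        mdist (f s) (f t) <= 2 * c].

(** As [d <= 1 <= l], a point within [d] of either end of [[0, 1 + l]] lies in the block carrying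
    that end; only the third bound sees the junction. *)
Lemma tame_paste d c l f g : d <= 1 -> 1 <= l -> f 1 = g 0 ->
  tame d c 1 f -> tame d c l g ->
  tame d c (1 + l) (paste 1 f (fun t => g (t - 1))).
Proof.
move=> d1 l1 fg [f0 f1 f2] [g0 g1 g2].
have E t : 1 <= t -> paste 1 f (fun t => g (t - 1)) t = g (t - 1).
  move=> t1; rewrite /paste; case: (leP t 1) => // t1'.
  by rewrite (_ : t = 1) ?subrr//; lra.
have E' t : t <= 1 -> paste 1 f (fun t => g (t - 1)) t = f t.
  by rewrite /paste => ->.
split.
- by move=> s s0 sl sd; rewrite !E' ?f0; lra.
- move=> s s0 sl sd; rewrite !E; try lra.
  by rewrite [1 + l - 1](_ : _ = l); [apply: g1|]; lra.
- move=> s t s0 st tl ts; have [t1|t1] := leP t 1.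
    by rewrite !E'; [apply: f2| |]; lra.
  have [s1|s1] := leP s 1; last by rewrite !E; [apply: g2| |]; lra.
  rewrite E'// E; last by lra.
  have H1 : mdist (f s) (f 1) <= c by apply: f1; lra.
  have H2 : mdist (g 0) (g (t - 1)) <= c by apply: g0; lra.
  rewrite (le_trans (metric_triangle _ (f 1) _))//.
  by rewrite {2}fg (_ : 2 * c = c + c) ?lerD//; lra.
Qed.

Lemma tame_scale d c l f : 1 <= l -> tame d c l f ->
  tame (l^-1 * d) c 1 (fun t => f (l * t)).
Proof.
move=> l1 [f0 f1 f2].
have l0 : 0 < l by lra.
have H r : (r <= l^-1 * d) = (l * r <= d) by rewrite mulrC ler_pdivlMr// mulrC.
have ler1 r : r <= 1 -> l * r <= l by move=> ?; rewrite ger_pMr.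
have ger0 r : 0 <= r -> 0 <= l * r by move=> ?; rewrite mulr_ge0// ltW.
split.
- by move=> s s0 s1; rewrite H mulr0 => ?; apply: f0; rewrite ?ger0 ?ler1.
- move=> s s0 s1; rewrite H mulrBr mulr1 => ?.
  by apply: f1; rewrite ?ger0 ?ler1.
- move=> s t s0 st t1; rewrite H mulrBr => ?.
  by apply: f2; rewrite ?ger0 ?ler1// ler_pM2l.
Qed.

Lemma tame_contraction d c l q h f : (forall x y, mdist (h x) (h y) <= q * mdist x y) ->
  0 <= q -> tame d c l f -> tame d (q * c) l (h \o f).
Proof.
move=> hq q0 [f0 f1 f2].
have H x y b : mdist x y <= b -> mdist (h x) (h y) <= q * b.
  by move=> xy; rewrite (le_trans (hq _ _))// ler_wpM2l.
split.
- by move=> *; apply: H; apply: f0.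
- by move=> *; apply: H; apply: f1.
- by move=> *; rewrite mulrCA; apply: H; apply: f2.
Qed.

(** The sublevel set is closed and belongs to the filter, so it contains every cluster point. *)
Lemma cluster_le (T : topologicalType) (F : set_system T) (p : T) (u : T -> R) c :
  continuous u -> cluster F p -> (\forall x \near F, u x <= c) -> u p <= c.
Proof.
move=> cu; rewrite clusterE => Fp Fc; have /= := Fp _ Fc.
have cl : closed [set x | u x <= c].
  by apply: (@closed_comp _ _ u [set r | r <= c]) => [x _|]; [exact: cu|exact: closed_le].
by move/closure_id : cl => <-.
Qed.

Lemma expr_small (q D e : R) : 0 <= q -> q < 1 -> 0 < e ->
  exists k : nat, q ^+ k * D < e.
Proof.
move=> q0 q1 e0.
have : (fun n => q ^+ n * D) @ \oo --> 0 * D.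
  by apply: cvgM; [apply: cvg_expr; rewrite ger0_norm|exact: cvg_cst].
rewrite mul0r => /cvgrPdist_lt/(_ _ e0)[k _ /(_ k (leqnn _))] /=.
by rewrite sub0r normrN => /(le_lt_trans (ler_norm _)); exists k.
Qed.

Variables (I : Type) (S : I -> X -> X) (K : set X) (q D : R).
Hypothesis S_K : forall i x, K x -> K (S i x).
Hypothesis S_q : forall i x y, mdist (S i x) (S i y) <= q * mdist x y.
Hypotheses (q0 : 0 <= q) (q1 : q < 1).
Hypothesis K_D : forall x y, K x -> K y -> mdist x y <= D.
Hypothesis K_compact : compact K.

Definition linked x y := exists i, (S i @` K) x /\ (S i @` K) y.

Fixpoint chain n x y :=
  if n is n'.+1 then exists2 z, linked x z & chain n' z y else x = y.

(** One substitution step: each link is filled with the image under some [S i] of a path of the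
    previous stage. These images occupy consecutive unit intervals, and the contraction gains one
    factor [q]. *)
Lemma chain_paths (N n m : nat) (delta : R) : 0 <= delta -> delta <= 1 ->
  (forall x y, K x -> K y -> exists f, [/\ f 0 = x, f 1 = y,
    forall t, K (f t) &
    forall k, (k <= n)%N -> tame (delta ^+ k) (q ^+ k * D) 1 f]) ->
  forall x y, chain m.+1 x y -> exists f, [/\ f 0 = x, f m.+1%:R = y,
    forall t, K (f t) &
    forall k, (k <= n)%N -> tame (delta ^+ k) (q ^+ k.+1 * D) m.+1%:R f].
Proof.
move=> d0 d1 IH; elim: m => [|m IHm] x y /=.
  move=> [z [i [[a Ka <-] [b Kb Sb]]] zy]; rewrite -{}zy -{}Sb.
  have [f [f0 f1 fK ft]] := IH _ _ Ka Kb.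
  exists (S i \o f); split => /=; rewrite ?f0 ?f1//.
    by move=> t; exact: S_K.
  by move=> k kn; rewrite exprS -mulrA; apply: tame_contraction => //; exact: ft.
move=> [z [i [[a Ka <-] [b Kb Sb]]]] /IHm[g [g0 gm gK gt]].
have [f [f0 f1 fK ft]] := IH _ _ Ka Kb.
exists (paste 1 (S i \o f) (fun t => g (t - 1))); split.
- by rewrite /paste ler01 /= f0.
- by rewrite /paste lern1 /= -natr1 addrK.
- by move=> t; rewrite /paste; case: ifP => _ //=; exact: S_K.
move=> k kn; rewrite -nat1r; apply: tame_paste.
- exact: exprn_ile1.
- by rewrite ler1n.
- by rewrite /= f1 g0 Sb.
- by rewrite exprS -mulrA; apply: tame_contraction => //; exact: ft.
- exact: gt.
Qed.

(** Rescaling [N.+2] unit intervals to [[0, 1]] divides the time scale by [N.+2] while the cost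
    shrinks by [q]. The maps need not be continuous: stage [n] controls the scales up to [n]
    only. *)
Lemma approx_paths N : (forall x y, K x -> K y -> chain N.+2 x y) ->
  forall n x y, K x -> K y -> exists f, [/\ f 0 = x, f 1 = y,
    forall t, K (f t) &
    forall k, (k <= n)%N -> tame (N.+2%:R^-1 ^+ k) (q ^+ k * D) 1 f].
Proof.
move=> KN.
have tame0 d f : (forall t, K (f t)) -> tame d (q ^+ 0 * D) 1 f.
  move=> fK; have H s t : mdist (f s) (f t) <= D by exact: K_D.
  have := H 0 0; rewrite mdistxx => D0.
  by rewrite expr0 mul1r; split => // s t *; rewrite (le_trans (H _ _))//; lra.
elim=> [|n IH] x y Kx Ky.
  (* A jump is allowed: at scale 0 the diameter bound [D] suffices. *)
  exists (fun t => if t <= 0 then x else y); split.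
  - by rewrite lexx.
  - by rewrite leNgt ltr01.
  - by move=> t; case: ifP.
  - by move=> k; rewrite leqn0 => /eqP ->; apply: tame0 => t; case: ifP.
have d1 : N.+2%:R^-1 <= 1 :> R by rewrite invf_le1// ler1n.
have d0 : 0 <= N.+2%:R^-1 :> R by [].
have [f [f0 fN fK ft]] := chain_paths 0 d0 d1 IH (KN _ _ Kx Ky).
exists (fun t => f (N.+2%:R * t)); rewrite mulr0 mulr1; split => //.
case=> [_|k kn]; first exact: tame0.
by rewrite exprS; apply: tame_scale; [rewrite ler1n|exact: ft].
Qed.

(** The estimate at scale [k] holds at all stages [n >= k], hence survives in a pointwise cluster
    point, which exists by Tychonoff. The limit satisfies the estimates at all scales and is
    therefore uniformly continuous. *)
Lemma chain_joined N : (forall x y, K x -> K y -> chain N.+2 x y) ->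
  forall x y, K x -> K y -> joined K x y.
Proof.
move=> KN x y Kx Ky.
have /choice[f_ Hf] := fun n => approx_paths KN n Kx Ky.
pose PT : topologicalType := prod_topology (fun _ : R => X).
have cP : compact [set f : PT | forall t, K (f t)].
  exact: (@tychonoff R (fun=> X) (fun=> K)).
have [|f [fK fcl]] := cP (f_ @ \oo) _.
  by exists 0%N => // n _; have [] := Hf n.
have cev t : continuous (fun f : PT => f t).
  exact: proj_continuous.
have lim_le s t c : (\forall n \near \oo, mdist (f_ n s) (f_ n t) <= c) ->
    mdist (f s) (f t) <= c.
  exact: (@cluster_le PT _ f (fun g => mdist (g s) (g t)) c
    (continuous_mdist (cev s) (cev t)) fcl).
have lim_eq s z : (forall n, f_ n s = z) -> f s = z.
  move=> fz; apply: mdist_positivity; apply/eqP.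
  rewrite eq_le mdist_ge0 andbT.
  have fz0 : \forall n \near \oo, mdist (f_ n s) z <= 0.
    by apply: nearW => n; rewrite fz mdistxx.
  have cz : continuous (fun _ : PT => z) by exact: cst_continuous.
  exact: (@cluster_le PT _ f (fun g => mdist (g s) z) 0
    (continuous_mdist (cev s) cz) fcl fz0).
have ft k s t : 0 <= s -> s <= t -> t <= 1 -> t - s <= N.+2%:R^-1 ^+ k ->
    mdist (f s) (f t) <= 2 * (q ^+ k * D).
  move=> s0 st t1 ts; apply: lim_le; exists k => // n /= kn.
  by have [_ _ _ /(_ k kn)[_ _]] := Hf n; exact.
(* The estimates hold on [[0, 1]] only. *)
exists (f \o clamp); split.
- move=> e e0; have e20 : 0 < e / 2 by lra.
  have [k Hk] := expr_small D q0 q1 e20.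
  have Hk' : 2 * (q ^+ k * D) < e by lra.
  have key s t : s <= t -> t - s < N.+2%:R^-1 ^+ k ->
      mdist (f (clamp s)) (f (clamp t)) < e.
    move=> st ts; have /andP[s0 s1] := clamp_itv s; have /andP[t0 t1] := clamp_itv t.
    have /andP[cst cts] := clamp_le st.
    by apply: le_lt_trans Hk'; apply: ft => //; lra.
  exists (N.+2%:R^-1 ^+ k); first by rewrite exprn_gt0.
  move=> s t /=; have [st|ts] := leP s t.
    by rewrite distrC ger0_norm ?subr_ge0//; exact: key.
  by rewrite ger0_norm ?subr_ge0 1?ltW// metric_sym; apply: key; exact: ltW.
- by rewrite /= clamp_id//; apply: lim_eq => n; have [] := Hf n.
- by rewrite /= clamp_id//; apply: lim_eq => n; have [] := Hf n.
- by move=> t; exact: fK.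
Qed.

End Hata.

(** * From paths to arcs *)

Section Gaps.
Context {R : realType}.
Implicit Types (x y : R) (U : set R).

Lemma last_before U x y : open U -> ~ U y -> y <= x ->
  exists a, [/\ ~ U a, a <= x & forall z, ~ U z -> z <= x -> z <= a].
Proof.
move=> oU Uy yx; pose B := ~` U `&` [set z | z <= x].
have B0 : B !=set0 by exists y.
have Bx : ubound B x by move=> z [].
have Bu : has_ubound B by exists x.
have cB : closed B.
  by apply: closedI; [rewrite closedC|exact: closed_le].
exists (sup B); have := closure_sup B0 Bu.
move/closure_id : cB => <- [? ?]; split => // z Uz zx.
by apply: ub_le_sup.
Qed.

Lemma first_after U x y : open U -> ~ U y -> x <= y ->
  exists b, [/\ ~ U b, x <= b & forall z, ~ U z -> x <= z -> b <= z].
Proof.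
move=> oU Uy xy.
have oU' : open (-%R @^-1` U).
  by apply: open_comp => // z _; exact: opp_continuous.
have Uy' : ~ (-%R @^-1` U) (- y) by rewrite /= opprK.
have [|a [Ua ax H]] := last_before oU' Uy' (x := - x); first by rewrite lerN2.
exists (- a); split => //; first by rewrite lerNr.
by move=> z Uz xz; rewrite lerNl; apply: H; rewrite ?lerN2//= opprK.
Qed.

(** [Fil] is generated by the upper tails of the chain. A member containing [z] contains a
    neighbourhood of [z], and so do all larger members: this is the covering condition near [z]. *)
Lemma compact_chain_cover (T : topologicalType) (A : set T) (F : set (set T)) :
  compact A -> F !=set0 -> (forall V, F V -> open V) -> total_on F subset ->
  A `<=` \bigcup_(V in F) V -> exists2 V, F V & A `<=` V.
Proof.
move=> cA [V0 FV0] oF totF AF.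
pose Fil := filter_from F (fun V => [set V' | F V' /\ V `<=` V']).
have FFil : Filter Fil.
  apply: filter_from_filter; first by exists V0.
  move=> V W FV FW; have [VW|WV] := totF _ _ FV FW.
    by exists W => // V' [FV' WV']; do !split => //; exact: subset_trans WV'.
  by exists V => // V' [FV' WV']; do !split => //; exact: subset_trans WV'.
have /compact_near_coveringP/(_ _ Fil (fun (V : set T) z => V z) FFil) := cA.
case=> [z Az|V FV H]; last by exists V => //; exact: (H V (conj FV (@subset_refl _ V))).
have [V FV Vz] := AF _ Az.
exists (V, [set V' | F V' /\ V `<=` V']) => /=.
  split; last by exists V.
  by apply: open_nbhs_nbhs; split => //; exact: oF.
by case=> w V' /= [Vw [_]]; apply.
Qed.

End Gaps.

(** * Collapsing the loops of a path *)

Section PathToArc.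
Context {R : realType} {X : metricType R}.
Implicit Types (f g : R -> X) (U V : set R).

(* Each component of [U] parametrizes a closed loop of [f], so collapsing these
   components turns [f] into a path again. *)
Definition loops f U :=
  [/\ open U, U `<=` `]0, 1[ &
      forall a b, a < b -> ~ U a -> ~ U b -> (forall c, a < c -> c < b -> U c) ->
      f a = f b].

(** Zorn applies because a component []a, b[] of the union of a chain lies, up to short ends, in one
    member [V]. The ends [a'], [b'] of the corresponding component of [V] are close to [a], [b], and
    [f a' = f b']. *)
Lemma maximal_loops f : ucont f ->
  exists2 U, loops f U & forall V, U `<=` V -> loops f V -> V `<=` U.
Proof.
move=> uf.
have [|U [lU maxU]] := @Zorn_bigcup R (loops f); last first.
  exists U => // V UV lV; apply: contrapT => VU.
  by apply: (maxU V) lV; split.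
move=> F Fl totF; split.
- by apply: bigcup_open => V /Fl[].
- by move=> x [V /Fl[_ V01 _] /V01].
move=> a b ab Ua Ub abU; apply/eqP/negPn; rewrite -mdist_gt0; apply/negP => fab.
have [e e0 He] : exists2 e, 0 < e & e = mdist (f a) (f b) / 2.
  by exists (mdist (f a) (f b) / 2) => //; lra.
have [d d0 Hd] := uf _ e0.
(* Below [d], so that moving an end by at most [h] costs less than [e]; the third keeps
   [[a + h, b - h]] nondegenerate. *)
pose h := Num.min d (b - a) / 3.
have [h0 hd hab] : [/\ 0 < h, h < d & 2 * h < b - a].
  rewrite /h; have := lexx (Num.min d (b - a)).
  rewrite le_min => /andP[].
  have : 0 < Num.min d (b - a) by rewrite lt_min d0 subr_gt0.
  by move: (Num.min _ _) => r ? ? ?; split; lra.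
have [V FV sV] : exists2 V, F V & `[a + h, b - h] `<=` V.
  apply: compact_chain_cover => //.
  - exact: segment_compact.
  - have [||V FV _] := abU ((a + b) / 2); [lra|lra|by exists V].
  - by move=> V /Fl[].
  - by move=> x /=; rewrite in_itv/= => /andP[? ?]; apply: abU; lra.
have [oV _ gapV] := Fl _ FV.
have nV x : ~ (\bigcup_(W in F) W) x -> ~ V x by move=> H Vx; apply: H; exists V.
have [|a' [Va' a'h Ha']] := last_before oV (nV _ Ua) (x := a + h); first lra.
have [|b' [Vb' b'h Hb']] := first_after oV (nV _ Ub) (x := b - h); first lra.
have aa' : a <= a' by apply: Ha' => //; [exact: nV|lra].
have bb' : b' <= b by apply: Hb' => //; [exact: nV|lra].
have fab' : f a' = f b'.
  apply: gapV => // [|c ac cb]; first by lra.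
  have [ch|hc] := leP c (a + h).
    by apply: contrapT => Vc; have := Ha' _ Vc ch; lra.
  have [hc'|ch'] := leP (b - h) c.
    by apply: contrapT => Vc; have := Hb' _ Vc hc'; lra.
  by apply: sV; rewrite /= in_itv/=; lra.
have H1 : mdist (f a) (f a') < e by apply: Hd; rewrite distrC ger0_norm; lra.
have H2 : mdist (f b') (f b) < e by apply: Hd; rewrite distrC ger0_norm; lra.
have := metric_triangle (f a) (f a') (f b); rewrite {2}fab'; lra.
Qed.

(** [g] is [f \o a], where [a x] is the last point up to [x] outside a maximal family [U] of loops.
    If [g s = g t], then []a s, a t[] may be added to [U], so by maximality it already lies in [U];
    as [a u] is outside [U], it is [a s] or [a t]. *)
Lemma monotone_path f : ucont f -> exists g, [/\ ucont g, g 0 = f 0, g 1 = f 1,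
  forall t, exists s, g t = f s &
  forall s u t, 0 <= s -> s <= u -> u <= t -> t <= 1 -> g s = g t -> g u = g s].
Proof.
move=> uf; have [U [oU U01 gapU] maxU] := maximal_loops uf.
have U_le0 x : x <= 0 -> ~ U x.
  by move=> x0 /U01; rewrite /= in_itv/=; lra.
have U_ge1 x : 1 <= x -> ~ U x.
  by move=> x0 /U01; rewrite /= in_itv/=; lra.
have /choice[a aP] : forall x, exists a,
    [/\ ~ U a, a <= x & forall z, ~ U z -> z <= x -> z <= a].
  move=> x; apply: (@last_before _ _ _ (Num.min 0 x)) => //.
    by apply: U_le0; rewrite ge_min lexx.
  by rewrite ge_min lexx orbT.
have /choice[b bP] : forall x, exists b,
    [/\ ~ U b, x <= b & forall z, ~ U z -> x <= z -> b <= z].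
  move=> x; apply: (@first_after _ _ _ (Num.max 1 x)) => //.
    by apply: U_ge1; rewrite le_max lexx.
  by rewrite le_max lexx orbT.
have ax x : a x <= x by have [] := aP x.
have xb x : x <= b x by have [] := bP x.
have nUa x : ~ U (a x) by have [] := aP x.
have nUb x : ~ U (b x) by have [] := bP x.
have aM x z : ~ U z -> z <= x -> z <= a x by have [_ _] := aP x; exact.
have bM x z : ~ U z -> x <= z -> b x <= z by have [_ _] := bP x; exact.
have a_id x : ~ U x -> a x = x.
  by move=> Ux; apply/eqP; rewrite eq_le ax aM.
have fab x : f (a x) = f (b x).
  have := le_trans (ax x) (xb x); rewrite le_eqVlt => /predU1P[->//|ab].
  apply: gapU => // c ac cb; apply: contrapT => Uc.
  have [cx|xc] := leP c x; first by have := aM _ _ Uc cx; lra.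
  by have := bM _ _ Uc (ltW xc); lra.
exists (f \o a); split => /=.
- move=> e e0; have [d d0 Hd] := uf _ e0; exists d => //.
  suff key s t : s <= t -> t - s < d -> mdist (f (a s)) (f (a t)) < e.
    move=> s t; have [st|ts] := leP s t.
      by rewrite distrC ger0_norm ?subr_ge0//; exact: key.
    by rewrite ger0_norm ?subr_ge0 1?ltW// metric_sym; apply: key; exact: ltW.
  move=> st ts.
  (* If [a t < s], no point of []a t, t]] is outside [U], hence [a s = a t]. Otherwise
     [f (a s) = f (b s)] with [s <= b s <= a t <= t]. *)
  have [sa|as_] := leP s (a t); last first.
    suff -> : a s = a t by rewrite mdistxx.
    apply/eqP; rewrite eq_le (aM t) ?(le_trans _ st)//= (aM s)//; exact: ltW.
  have ba : b s <= a t by exact: bM.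
  have sb := xb s; have at_ := ax t.
  by rewrite fab; apply: Hd; rewrite distrC ger0_norm; lra.
- by rewrite a_id//; exact: U_le0.
- by rewrite a_id//; exact: U_ge1.
- by move=> t; exists (a t).
move=> s u t s0 su ut t1 fst.
have ast : a s <= a t by apply: aM => //; rewrite (le_trans (ax _))// (le_trans su).
move: ast; rewrite le_eqVlt => /predU1P[ast|ast].
  suff -> : a u = a s by [].
  have nle := ax u; have nsu := aM u _ (nUa s) (le_trans (ax s) su).
  apply/eqP; rewrite eq_le nsu andbT ast; apply: aM => //; exact: le_trans ut.
have as0 : 0 <= a s by apply: aM => //; exact: U_le0.
have at1 : a t <= 1 by rewrite (le_trans (ax t)).
have W_loops : loops f (U `|` `]a s, a t[).
  split; first by apply: openU => //; exact: interval_open.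
    by move=> x [/U01//|]; rewrite /= !in_itv/=; lra.
  move=> a' b' ab' /not_orP[Ua' Ia'] /not_orP[Ub' Ib'] abU.
  (* As [a s] and [a t] stay outside the enlarged set, each of its components is []a s, a t[] itself
     or a component of [U]. *)
  have nW : ~ (U `|` `]a s, a t[) (a s) /\ ~ (U `|` `]a s, a t[) (a t).
    by split=> -[/nUa//|]; rewrite /= in_itv/= ltxx// andbF.
  move: Ia' Ib'; rewrite /= !in_itv/= => /negP Ia' /negP Ib'.
  have [ta'|a't] := leP (a t) a'.
    apply: gapU => // c ac cb; have [//|] := abU c ac cb.
    by rewrite /= in_itv/=; lra.
  have [b's|sb'] := leP b' (a s).
    apply: gapU => // c ac cb; have [//|] := abU c ac cb.
    by rewrite /= in_itv/=; lra.
  have a's : a' <= a s by move: Ia'; rewrite a't andbT -leNgt.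
  have tb' : a t <= b' by move: Ib'; rewrite sb' /= -leNgt.
  have -> : a' = a s.
    apply/eqP; rewrite eq_le a's leNgt; apply/negP => a's'.
    by apply: nW.1; apply: abU => //; lra.
  have -> : b' = a t; last by [].
  apply/eqP; rewrite eq_le tb' andbT leNgt; apply/negP => a's'.
  by apply: nW.2; apply: abU => //; lra.
have sub := maxU _ (@subsetUl _ _ _) W_loops.
have [->//|aus] := eqVneq (a u) (a s).
have [->//|aut] := eqVneq (a u) (a t).
case: (nUa u); apply: sub; right; rewrite /= in_itv/= !lt_neqAle eq_sym aus aut /=.
by apply/andP; split; apply: aM => //; exact: le_trans (ax _) _.
Qed.

End PathToArc.

(** * Geometrically weighted series *)

Section WeightedSum.
Context {R : realType}.
Implicit Types (x y : nat -> R) (D c : R).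

(** The weights [1 / 2 ^ (k + 1)] add up to 1, so a uniform bound on the terms passes unchanged to
    the sum. *)
Definition weighted x : nat -> R := fun k => x k / (2 ^ (k + 1))%:R.

Definition weighted_sum x : R := limn (series (weighted x)).

Let w0 k : 0 < (2 ^ (k + 1))%:R :> R.
Proof. by rewrite ltr0n expn_gt0. Qed.

Lemma weighted_cst c : series (weighted (fun=> c)) @ \oo --> c.
Proof. by have := cvg_geometric_series_half c 0; rewrite expr0 divr1. Qed.

Lemma is_cvg_weighted D x : (forall n, 0 <= x n <= D) ->
  cvgn (series (weighted x)).
Proof.
move=> xD; apply: (@series_le_cvg _ _ (weighted (fun=> D))).
- by move=> n; have /andP[? ?] := xD n; rewrite divr_ge0// ltW.
- move=> n; have /andP[? ?] := xD n.
  by apply: divr_ge0; [lra|exact: ltW].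
- by move=> n; have /andP[? ?] := xD n; rewrite ler_pM2r// invr_gt0.
- by apply: cvgP; exact: weighted_cst.
Qed.

Lemma weighted_sum_le D c x y : (forall n, 0 <= x n <= D) ->
  (forall n, 0 <= y n <= D) -> (forall n, x n <= y n + c) ->
  weighted_sum x <= weighted_sum y + c.
Proof.
move=> xD yD xy.
have cx := is_cvg_weighted xD; have cy := is_cvg_weighted yD.
have cc := cvgP _ (weighted_cst (c := c)).
rewrite /weighted_sum -[X in _ <= _ + X](cvg_lim _ (weighted_cst (c := c)))//.
rewrite -lim_seriesD//.
apply: lim_series_le => //; first exact: is_cvg_seriesD.
by move=> n; rewrite /= -mulrDl ler_pM2r ?invr_gt0.
Qed.

(** Every partial sum of the differences that includes index [k] is at least that positive term. *)
Lemma weighted_sum_lt D x y k : (forall n, 0 <= x n <= D) ->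
  (forall n, 0 <= y n <= D) -> (forall n, x n <= y n) -> x k < y k ->
  weighted_sum x < weighted_sum y.
Proof.
move=> xD yD xy xyk.
have cx := is_cvg_weighted xD; have cy := is_cvg_weighted yD.
rewrite -subr_gt0 -lim_seriesB//.
apply: (@lt_le_trans _ _ ((y k - x k) / (2 ^ (k + 1))%:R)).
  by rewrite divr_gt0// subr_gt0.
apply: limr_ge; first exact: is_cvg_seriesB.
exists k.+1 => // n /= kn.
have E i : (weighted y - weighted x) i = (y i - x i) / (2 ^ (i + 1))%:R.
  by rewrite mulrBl.
rewrite /series /= (bigD1_seq k) ?iota_uniq//=; last by rewrite mem_index_iota.
rewrite E lerDl sumr_ge0// => i _.
by rewrite E divr_ge0 ?subr_ge0// ltW.
Qed.

End WeightedSum.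

(** * Injective reparametrization of monotone paths *)

Section Reparametrization.
Context {R : realType} {X : metricType R}.
Implicit Types (f g : R -> X) (A : set X).

Definition simple_arc A x y := exists g, [/\ ucont g, g 0 = x, g 1 = y,
  forall t, A (g t) & forall s t, 0 <= s <= 1 -> 0 <= t <= 1 -> g s = g t -> s = t].

(** A continuous nondecreasing [h] with the same fibres as [g] on [[0, 1]] is built, and [sigma]
    picks parameters at which [h] grows affinely from [h 0] to [h 1]. The choice [sigma] need not be
    continuous, but [g \o sigma] is. *)
Lemma monotone_arc g D : ucont g -> (forall s t, mdist (g s) (g t) <= D) ->
  g 0 <> g 1 ->
  (forall s u t, 0 <= s -> s <= u -> u <= t -> t <= 1 -> g s = g t -> g u = g s) ->
  simple_arc (range g) (g 0) (g 1).
Proof.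
move=> ug gD g01 gmon.
(* Every rational occurs in this enumeration; indices that decode to nothing get 0. *)
pose q n : R := if @unpickle rat n is Some r then ratr r else 0.
(* The element 0 keeps the supremum meaningful, with value 0, when [t < q n]. *)
pose E n t := [set r | r = 0 \/
  exists u, [/\ q n <= u, u <= t & r = mdist (g (q n)) (g u)]].
have D0 : 0 <= D by rewrite (le_trans _ (gD 0 0))// mdistxx.
have E0 n t : E n t 0 by left.
have ED n t : ubound (E n t) D by move=> r [->//|[u [_ _ ->]]].
have Eub n t : has_ubound (E n t) by exists D.
have Ene n t : E n t !=set0 by exists 0.
pose phi t n := sup (E n t).
have phiD t n : 0 <= phi t n <= D.
  by rewrite ub_le_sup//= ge_sup.
have phi_le s t n : s <= t -> phi s n <= phi t n.
  move=> st; apply: ge_sup => // r [->|[u [qu us ->]]]; first exact: ub_le_sup.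
  by apply: ub_le_sup => //; right; exists u; split => //; exact: le_trans st.
have phi_step s t n c : s <= t -> 0 <= c ->
    (forall u, s <= u -> u <= t -> mdist (g s) (g u) <= c) ->
    phi t n <= phi s n + 2 * c.
  move=> st c0 H; apply: ge_sup => // r.
  have /andP[p0 _] := phiD s n.
  case=> [->|[u [qu ut ->]]]; first by lra.
  have [us|su] := leP u s.
    rewrite (@le_trans _ _ (phi s n))//; last by lra.
    by apply: ub_le_sup => //; right; exists u.
  have Hu := H u (ltW su) ut.
  rewrite (le_trans (metric_triangle _ (g s) _))//.
  have [qs|sq] := leP (q n) s.
    suff : mdist (g (q n)) (g s) <= phi s n by lra.
    by apply: ub_le_sup => //; right; exists s.
  have : mdist (g s) (g (q n)) <= c by apply: H; lra.
  by rewrite metric_sym; lra.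
(* [phi t n] is the greatest distance from [g (q n)] reached by [g] on
   [[q n, t]]; hence [h] is constant exactly where [g] is. *)
pose h t := weighted_sum (phi t).
have h_step s t c : s <= t -> 0 <= c ->
    (forall u, s <= u -> u <= t -> mdist (g s) (g u) <= c) -> h t <= h s + 2 * c.
  move=> st c0 H; apply: weighted_sum_le => // n; exact: phi_step.
have h_le s t : s <= t -> h s <= h t.
  move=> st; rewrite -[h t]addr0; apply: weighted_sum_le => // n.
  by rewrite addr0 phi_le.
have gh s t : 0 <= s -> s <= t -> t <= 1 -> g s = g t -> h s = h t.
  move=> s0 st t1 gst; apply/eqP; rewrite eq_le h_le//=.
  rewrite -[leRHS]addr0 -[X in _ + X](mulr0 2); apply: h_step => // u su ut.
  by rewrite (gmon s u t) ?mdistxx.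
have hg_lt s t : s < t -> g s <> g t -> h s < h t.
  move=> st /eqP gst.
  have e0 : 0 < mdist (g s) (g t) by rewrite mdist_gt0.
  have [d d0 Hd] := ug _ e0.
  (* A rational [r] so close after [s] that [g] at [r] still differs from [g t]: its term is 0 at
     [s] and positive at [t]. *)
  have [|r] := @rat_in_itvoo _ s (Num.min t (s + d)).
    by rewrite lt_min st ltrDl.
  rewrite in_itv/= lt_min => /and3P[sr rt rd].
  have qr : q (pickle r) = ratr r by rewrite /q pickleK.
  apply: (@weighted_sum_lt _ D _ _ (pickle r)) => // [n|]; first exact/phi_le/ltW.
  apply: (@le_lt_trans _ _ 0).
    by apply: ge_sup => // z [->//|[u []]]; rewrite qr; lra.
  apply: (@lt_le_trans _ _ (mdist (g (ratr r)) (g t))); last first.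
    by apply: ub_le_sup => //; right; exists t; rewrite qr; split => //; exact: ltW.
  rewrite mdist_gt0; apply/eqP => grt.
  have := Hd s (ratr r); rewrite grt distrC ger0_norm ?subr_ge0 1?ltW//.
  by rewrite ltxx => H; suff : false by []; apply: H; lra.
have hg s t : h s = h t -> g s = g t.
  wlog st : s t / s < t.
    by have [st|ts|->//] := ltgtP s t => H hst; [exact: H|apply/esym/H].
  move=> hst; apply: contrapT => /(hg_lt _ _ st); rewrite hst ltxx//.
have ch : continuous h.
  move=> t; apply/cvgrPdist_lt => e e0.
  have [|d d0 Hd] := ug (e / 4); first by lra.
  suff key (s u : R) : s <= u -> u - s < d -> `|h u - h s| < e.
    near=> s; have std : `|s - t| < d.
      by rewrite distrC; near: s; exact: cvgr_dist_lt.
    have [st|ts] := leP s t.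
      by move: std; rewrite distrC ger0_norm ?subr_ge0//; exact: key.
    move: std; rewrite [`|h t - _|]distrC ger0_norm ?subr_ge0 1?ltW//.
    by apply: key; exact: ltW.
  move=> su us; rewrite ger0_norm ?subr_ge0 ?h_le//.
  have : h u <= h s + 2 * (e / 4).
    apply: h_step => //; first by lra.
    by move=> v sv vu; apply/ltW/Hd; rewrite distrC ger0_norm; lra.
  by lra.
have h01 : h 0 < h 1 by exact: hg_lt.
have /choice[sigma Hs] : forall v : R, exists t, [/\ 0 <= t, t <= 1 &
    h t = h 0 + clamp v * (h 1 - h 0)].
  move=> v; have /andP[v0 v1] := clamp_itv v.
  have [|||t] := @IVT R h 0 1 (h 0 + clamp v * (h 1 - h 0)) => //.
  - exact: continuous_subspaceT.
  - rewrite min_l ?max_r ?(ltW h01)//.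
    have := mulr_ge0 v0 (ltW (_ : 0 < h 1 - h 0)); rewrite subr_gt0 => /(_ h01).
    have := @ler_wpM2r _ (h 1 - h 0) _ _ _ v1; rewrite subr_ge0 => /(_ (ltW h01)).
    by lra.
  - by rewrite in_itv/= => /andP[? ?] ?; exists t.
exists (g \o sigma); split => /=.
- move=> e e0.
  (* On the unit square, equal values of [h] force equal values of [g]; by compactness, close values
     of [h] force close values of [g] uniformly. *)
  have [||||d d0 Hd] := @compact_modulus R (R * R)%type
    (`[0, 1]%classic `*` `[0, 1]%classic) (fun p : R * R => `|h p.1 - h p.2|)
    (fun p => mdist (g p.1) (g p.2))
    _ _ _ _ e e0.
  + by apply: compact_setX; exact: segment_compact.
  + move=> p; apply: cvg_norm; apply: cvgB.
    * by apply: continuous_comp; [exact: cvg_fst|exact: ch].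
    * by apply: continuous_comp; [exact: cvg_snd|exact: ch].
  + apply: continuous_mdist => p.
    * by apply: continuous_comp; [exact: cvg_fst|exact: ucont_continuous].
    * by apply: continuous_comp; [exact: cvg_snd|exact: ucont_continuous].
  + move=> p _; rewrite normr_le0 subr_eq0 => /eqP/hg ->; by rewrite mdistxx.
  have H0 : 0 < h 1 - h 0 by lra.
  exists (d / (h 1 - h 0)); first by rewrite divr_gt0.
  move=> s t; rewrite ltr_pdivlMr// => st.
  have [s0 s1 hs] := Hs s; have [t0 t1 ht] := Hs t.
  apply: (Hd (sigma s, sigma t)); first by split; rewrite /= in_itv/= ?s0 ?t0.
  rewrite /= hs ht (_ : _ - _ = (clamp s - clamp t) * (h 1 - h 0)); last by lra.
  rewrite normrM (ger0_norm (ltW H0)) (le_lt_trans _ st)//.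
  by apply: ler_wpM2r; [exact: ltW|exact: clamp_dist].
- by apply: hg; have [_ _ ->] := Hs 0; rewrite clamp_id// mul0r addr0.
- by apply: hg; have [_ _ ->] := Hs 1; rewrite clamp_id// mul1r addrC subrK.
- by move=> t; exists (sigma t).
move=> s t /andP[s0 s1] /andP[t0 t1] gst.
have [s0' s1' hs] := Hs s; have [t0' t1' ht] := Hs t.
have : h (sigma s) = h (sigma t).
  have [st|ts] := leP (sigma s) (sigma t); first exact: gh.
  by apply/esym/gh => //; exact: ltW.
rewrite hs ht !clamp_id// => /addrI /mulIf; apply.
by rewrite subr_eq0 gt_eqF.
Unshelve. all: by end_near. Qed.

Lemma joined_simple_arc A x y : compact A -> joined A x y -> x <> y -> simple_arc A x y.
Proof.
move=> /compact_mdist_bounded[D _ AD] [f [uf f0 f1 Af]] xy.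
have [g [ug g0 g1 gf gmon]] := monotone_path uf.
have gA t : A (g t).
  by have [s ->] := gf t; exact: Af.
have [||c [uc c0 c1 cg ci]] := @monotone_arc g D ug _ _ gmon.
- by move=> s t; exact: AD.
- by rewrite g0 g1 f0 f1.
exists c; split => //; rewrite ?c0 ?c1 ?g0 ?g1//.
by move=> t; have [s _ <-] := cg t; exact: gA.
Qed.

End Reparametrization.

(** * Simple closed curves *)

Section FiniteConnected.
Context {R : realType} {X : metricType R}.
Implicit Types (A B C F K : set X).

Lemma closed_finite F : finite_set F -> closed F.
Proof.
by move=> fF; apply: compact_closed (finite_compact fF); exact: metric_hausdorff.
Qed.

(** The trace of [A] on [C] is open in [C], and closed because it is finite. *)
Lemma connected_open_finite C A : connected C -> open A -> C `&` A !=set0 ->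
  finite_set (C `&` A) -> C `<=` A.
Proof.
move=> cC oA CA0 fCA; suff CAC : C `&` A = C by rewrite -CAC => x [].
apply: cC => //; first by exists A.
by exists (C `&` A); [exact: closed_finite|rewrite setIA setIid].
Qed.

Lemma connected_finite C x y : connected C -> finite_set C -> C x -> C y -> x = y.
Proof.
move=> cC fC Cx Cy; have fCx : finite_set (C `\ x) by exact: finite_setD.
have sub : C `<=` ~` (C `\ x).
  apply: connected_open_finite => //.
  - by apply: closed_openC; exact: closed_finite.
  - by exists x; split => // -[_ /(_ erefl)].
  - exact: finite_setIl.
by apply: contrapT => xy; apply: (sub y) => //; split => // yx; exact: xy.
Qed.

Lemma joined_connected K : (forall x y, K x -> K y -> joined K x y) -> connected K.
Proof.
move=> KK; have [[x Kx]|K0] := pselect (K !=set0); last first.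
  by move/nonemptyPn : K0 => ->; exact: connected0.
have /choice[f fP] : forall y, exists f : R -> X, K y ->
    [/\ ucont f, f 0 = x, f 1 = y & forall t, K (f t)].
  move=> y; have [Ky|nKy] := pselect (K y); last by exists (fun=> x).
  by have [f Hf] := KK x y Kx Ky; exists f.
rewrite (_ : K = \bigcup_(y in K) range (f y)).
  apply: bigcup_connected.
    by exists x => y Ky; have [_ <- _ _] := fP y Ky; exists 0.
  move=> y Ky; have [uf _ _ _] := fP y Ky.
  apply: connected_continuous_connected.
    by apply/connected_intervalP.
  by apply: continuous_subspaceT; exact: ucont_continuous.
apply/seteqP; split => [y Ky|y [z Kz [t _ <-]]].
  by exists y => //; have [_ _ f1 _] := fP y Ky; exists 1.
by have [_ _ _] := fP z Kz.
Qed.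

End FiniteConnected.

(** * Removing a point, pulling back, gluing arcs *)

Section ClosedCurves.
Context {R : realType} {X : metricType R}.
Implicit Types (A B C K : set X).

Lemma curve_connected (gamma : R -> X) (i : interval R) :
  {within `[0, 1], continuous gamma} -> [set` i] `<=` `[0, 1] ->
  connected (gamma @` [set` i]).
Proof.
move=> cg i01; apply: connected_continuous_connected.
  by apply/connected_intervalP; exact: interval_is_interval.
exact: continuous_subspaceW i01 cg.
Qed.

(** Without [gamma t0], the curve is the image of an open interval when [t0 = 0], and otherwise two
    half-open arcs sharing the point [gamma 0 = gamma 1]. *)
Lemma simple_closed_curve_setD1 C p : simple_closed_curve C -> connected (C `\ p).
Proof.
move=> [gamma [cg g01 ginj <-]].
have inj s t : 0 <= s -> s < 1 -> 0 <= t -> t < 1 -> gamma s = gamma t -> s = t.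
  by move=> *; apply: ginj; rewrite // in_itv/=; apply/andP.
have [[t0 [t00 t01] gt0]|np] := pselect (exists2 t, 0 <= t /\ t < 1 & gamma t = p);
    last first.
  rewrite (_ : _ `\ p = gamma @` `[0, 1]); first exact: curve_connected.
  apply/seteqP; split => [x []//|_ [t t01 <-]]; split; first by exists t.
  move=> /= gtp; move: t01; rewrite /= in_itv/= => /andP[t0 t1].
  apply: np; move: t1; rewrite le_eqVlt => /predU1P[te|t1]; last by exists t.
  by exists 0; rewrite // g01 -te.
move: t00; rewrite le_eqVlt => /predU1P[t00|t00].
  rewrite (_ : _ `\ p = gamma @` `]0, 1[).
    by apply: curve_connected => // t; rewrite /= !in_itv/=; lra.
  rewrite -gt0 -t00; apply/seteqP; split => [x [[t + <-]]|x [t + <-]].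
    rewrite /= in_itv/= => /andP[t0' t1] gtp; exists t => //.
    rewrite /= in_itv/= !lt_neqAle t0' t1 !andbT; apply/andP; split.
      by apply/eqP => t0e; apply: gtp; rewrite -t0e.
    by apply/eqP => t1e; apply: gtp; rewrite t1e -g01.
  rewrite /= in_itv/= => /andP[t0' t1]; split.
    by exists t => //; rewrite /= in_itv/= !ltW.
  move=> /= gtp; suff : t = 0 by lra.
  by apply: inj => //; exact: ltW.
rewrite (_ : _ `\ p = gamma @` `[0, t0[ `|` gamma @` `]t0, 1]).
  apply: connectedU.
  - exists (gamma 0); split; first by exists 0; rewrite //= in_itv/= lexx.
    by rewrite g01; exists 1; rewrite //= in_itv/= lexx t01.
  - by apply: curve_connected => // t; rewrite /= !in_itv/=; lra.
  - by apply: curve_connected => // t; rewrite /= !in_itv/=; lra.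
rewrite -gt0; apply/seteqP; split => [x [[t + <-]]|x].
  rewrite /= in_itv/= => /andP[t0' t1] gtp.
  have [tt|tt|te] := ltgtP t t0; [left|right|by case: gtp; rewrite te].
    by exists t; rewrite //= in_itv/= t0'.
  by exists t; rewrite //= in_itv/= t1 andbT.
case=> -[t + <-]; rewrite /= in_itv/= => /andP[ta tb].
  split; first by exists t => //; rewrite /= in_itv/=; lra.
  move=> /= gtp; suff : t = t0 by lra.
  by apply: inj => //; lra.
split; first by exists t => //; rewrite /= in_itv/=; lra.
move=> /= gtp; move: tb; rewrite le_eqVlt => /predU1P[te|t1].
  suff : 0 = t0 by lra.
  by apply: inj => //; rewrite ?ltW// g01 -te.
suff : t = t0 by lra.
by apply: inj => //; lra.
Qed.

Lemma simple_closed_curve_connected C : simple_closed_curve C -> connected C.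
Proof. by move=> [gamma [cg _ _ <-]]; exact: curve_connected. Qed.

Lemma simple_closed_curve_ex2 C : simple_closed_curve C ->
  exists x y, [/\ C x, C y & x <> y].
Proof.
move=> [gamma [cg g01 ginj <-]]; exists (gamma 0), (gamma (1 / 2)); split.
- by exists 0; rewrite //= in_itv/= lexx ler01.
- by exists (1 / 2); rewrite //= in_itv/=; lra.
- by move=> /ginj; rewrite !in_itv/= => H; suff : 0 = 1 / 2 :> R by [lra|]; apply: H; lra.
Qed.

Lemma simple_closed_curve_infinite C : simple_closed_curve C -> infinite_set C.
Proof.
move=> sC fC; have [x [y [Cx Cy]]] := simple_closed_curve_ex2 sC; apply.
exact: connected_finite (simple_closed_curve_connected sC) fC Cx Cy.
Qed.

(** On the compact [K] the injection [f] has a continuous inverse, through which the parametrization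
    is pulled back. *)
Lemma simple_closed_curve_preimage (f : X -> X) K C :
  compact K -> continuous f -> injective f ->
  simple_closed_curve C -> C `<=` f @` K ->
  exists2 C', simple_closed_curve C' & C' `<=` K /\ C = f @` C'.
Proof.
move=> cK cf finj [gamma [cg g01 ginj gC]] CfK.
have /choice[delta dP] : forall t, exists x, 0 <= t <= 1 -> K x /\ f x = gamma t.
  move=> t; have [t01|nt] := pselect (0 <= t <= 1); last by exists (gamma t).
  have [|x Kx fx] := CfK (gamma t); last by exists x.
  by rewrite -gC; exists t.
exists (delta @` `[0, 1]); last split.
- exists delta; split => //.
  + apply/subspace_continuousP => t; rewrite /= in_itv/= => t01.
    apply/metricType_numDomainType.cvgrPdist_lt => e e0.
    have [Kdt fdt] := dP t t01.
    have [||y Ky H|d d0 Hd] := @compact_modulus R X K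
      (fun y => mdist (f (delta t)) (f y)) (fun y => mdist (delta t) y) cK _ _ _ e e0.
    * by apply: continuous_mdist => //; exact: cst_continuous.
    * by apply: continuous_mdist => y; [exact: cst_continuous|exact: cvg_id].
    * suff -> : delta t = y by rewrite mdistxx.
      by apply/finj/mdist_positivity/eqP; rewrite eq_le H mdist_ge0.
    have := iffLR (subspace_continuousP _ _) cg t; rewrite /= in_itv/= => /(_ t01).
    move=> /metricType_numDomainType.cvgrPdist_lt/(_ _ d0).
    rewrite !near_withinE; apply: filterS => s Hs s01.
    have [Kds fds] := dP s s01.
    by apply: Hd => //; rewrite fdt fds; exact: Hs.
  + by apply: finj; have [|_ ->] := dP 0; rewrite ?lexx ?ler01//;
      have [|_ ->] := dP 1; rewrite ?lexx ?ler01.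
  + move=> s t; rewrite !in_itv/= => /andP[s0 s1] /andP[t0 t1] dst.
    apply: ginj; rewrite ?in_itv/= ?s0 ?t0//.
    have [|_ <-] := dP s; first by rewrite s0 ltW.
    by have [|_ <-] := dP t; [rewrite t0 ltW|rewrite dst].
- by move=> _ [t + <-]; rewrite /= in_itv/= => /dP[].
- rewrite -gC; apply/seteqP; split => [_ [t t01 <-]|_ [_ [t t01 <-] <-]].
    exists (delta t); first by exists t.
    by have [] := dP t; first by move: t01; rewrite /= in_itv.
  by exists t => //; have [] := dP t; first by move: t01; rewrite /= in_itv.
Qed.

Lemma glue_arcs A B x y : simple_arc A x y -> simple_arc B x y -> finite_set (A `&` B) ->
  exists2 C, simple_closed_curve C & C `<=` A `|` B.
Proof.
move=> [f [uf f0 f1 fA finj]] [g [ug g0 g1 gB ginj]] fAB.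
(* The curve follows [f] until it first meets [g] again, and returns along [g]. *)
pose F := [set t | 0 < t <= 1 /\ exists2 s, 0 <= s <= 1 & g s = f t].
have fF : finite_set F.
  suff : finite_set (f @` F).
    rewrite (eq_finite_set (inj_card_eq _))// => s t /set_mem[/andP[s0 s1] _].
    by move=> /set_mem[/andP[t0 t1] _]; apply: finj; lra.
  apply: sub_finite_set fAB => _ [t [_ [s _ gs]] <-].
  by split; [exact: fA|rewrite -gs].
(* Finite, hence closed, [F] has a least element [b]: the first return to [g]. *)
have oF : open (~` F).
  apply: closed_openC; apply: compact_closed (finite_compact fF).
  exact: norm_hausdorff.
have F1 : F 1 by split; [rewrite ltr01 lexx|exists 1; rewrite ?ler01 ?lexx// f1].
have nF t : F t -> ~ (~` F) t by move=> Ft /(_ Ft).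
have [b [/contrapT Fb b0 bmin]] := first_after oF (nF _ F1) ler01.
have {}bmin t : F t -> b <= t.
  by move=> Ft; apply: bmin; [exact: nF|case: Ft => /andP[/ltW]].
have [/andP[bp b1] [c /andP[cge0 c1] gc]] := Fb.
have xy : x <> y.
  rewrite -f0 -f1 => /finj H; suff : 0 = 1 :> R by lra.
  by apply: H; lra.
have c0 : 0 < c.
  rewrite lt_neqAle cge0 andbT; apply/eqP => c0.
  move: gc; rewrite -c0 g0 -f0 => /finj H; suff : 0 = b by lra.
  by apply: H; lra.
have bs s : 0 <= s -> s <= 1 / 2 -> 0 <= (2 * b) * s + 0 <= b.
  move=> s0 s1; rewrite addr0 mulr_ge0//=; last by lra.
  by rewrite mulrAC -[leRHS]mul1r ler_pM2r//; lra.
have ct t : 1 / 2 < t -> t <= 1 -> 0 <= (- (2 * c)) * t + 2 * c < c.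
  move=> t0 t1; have -> : - (2 * c) * t + 2 * c = (2 - 2 * t) * c by lra.
  rewrite mulr_ge0//=; last by lra.
  by rewrite -[ltRHS]mul1r ltr_pM2r//; lra.
(* The first half runs along [f] from parameter 0 to [b], the second along [g] from [c] back to
   0. *)
pose gamma := paste (1 / 2) (fun t => f ((2 * b) * t + 0))
  (fun t => g ((- (2 * c)) * t + 2 * c)).
have ugamma : ucont gamma.
  apply: ucont_paste; [exact: ucont_affine|exact: ucont_affine|].
  have -> : 2 * b * (1 / 2) + 0 = b by lra.
  by have -> : - (2 * c) * (1 / 2) + 2 * c = c by lra.
have gl t : t <= 1 / 2 -> gamma t = f ((2 * b) * t + 0).
  by rewrite /gamma /paste => ->.
have gr t : 1 / 2 < t -> gamma t = g ((- (2 * c)) * t + 2 * c).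
  by rewrite /gamma /paste ltNge => /negbTE ->.
have b20 : 2 * b != 0 by rewrite mulf_neq0// gt_eqF.
have c20 : - (2 * c) != 0 by rewrite oppr_eq0 mulf_neq0// gt_eqF.
(* The halves could meet only at [s = 0], where injectivity of [g] would give [t = 1], or at a
   parameter of [F], equal to [b] by minimality, which would give [t = 1 / 2]. *)
have cross s t : 0 <= s -> s <= 1 / 2 -> 1 / 2 < t -> t < 1 -> gamma s <> gamma t.
  move=> s0 s1 t0 t1; rewrite gl// gr// => fg.
  have /andP[fs0 fsb] := bs s s0 s1; have /andP[gt0 gtc] := ct t t0 (ltW t1).
  have [se|sne] := eqVneq s 0.
    move: fg; rewrite se mulr0 addr0 f0 -g0 => /ginj H.
    have : 0 = - (2 * c) * t + 2 * c.
      by apply: H; rewrite ?lexx ?ler01 ?gt0//= (le_trans (ltW gtc)).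
    have -> : - (2 * c) * t + 2 * c = 2 * c * (1 - t) by lra.
    by apply/eqP; rewrite lt_eqF// mulr_gt0//; lra.
  have Fs : F ((2 * b) * s + 0).
    split; last by exists (- (2 * c) * t + 2 * c) => //; rewrite gt0 (le_trans (ltW gtc)).
    by rewrite (le_trans fsb)// addr0 andbT mulr_gt0// ?mulr_gt0// lt_neqAle eq_sym sne.
  have sb : (2 * b) * s + 0 = b by apply/eqP; rewrite eq_le fsb bmin.
  move: fg; rewrite sb -gc => /ginj H.
  have : c = - (2 * c) * t + 2 * c; last by lra.
  by apply: H; rewrite ?cge0 ?gt0//= (le_trans (ltW gtc)).
exists (gamma @` `[0, 1]).
  exists gamma; split => //.
  - by apply: continuous_subspaceT; exact: ucont_continuous.
  - rewrite gl ?divr_ge0// gr ?mulr0 ?addr0 ?f0; last by lra.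
    by rewrite mulr1 addNr g0.
  - move=> s t; rewrite !in_itv/= => /andP[s0 s1] /andP[t0 t1].
    have [sl|sr] := leP s (1 / 2); have [tl|tr] := leP t (1 / 2).
    + rewrite !gl// => /finj H.
      have /andP[? ?] := bs s s0 sl; have /andP[? ?] := bs t t0 tl.
      by apply: (mulfI b20); apply: (addIr 0); apply: H; rewrite (le_trans _ b1)// andbT.
    + by move=> H; case: (cross s t).
    + by move=> H; case: (cross t s).
    + rewrite !gr// => /ginj H.
      have /andP[? sc] := ct s sr (ltW s1); have /andP[? tc] := ct t tr (ltW t1).
      apply: (mulfI c20); apply: (addIr (2 * c)).
      by apply: H; rewrite (le_trans _ c1) ?andbT// ltW.
move=> _ [t _ <-]; rewrite /gamma /paste; case: ifP => _; [left|right].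
  exact: fA.
exact: gB.
Qed.

End ClosedCurves.

(** * The intersection graph *)

Section Reachability.
Context {V : eqType}.
Implicit Types (e : rel V) (a : pred V) (u v w : V).

Definition reach e a u v :=
  exists r, [/\ path e u r, last u r = v & all a (u :: r)].

Lemma reach_refl e a u : a u -> reach e a u u.
Proof. by move=> au; exists [::]; split => //=; rewrite au. Qed.

Lemma reach_trans e a u v w : reach e a u v -> reach e a v w -> reach e a u w.
Proof.
move=> [r [er <- ar]] [s [es <- /= /andP[_ as_]]]; exists (r ++ s); split.
- by rewrite cat_path er.
- by rewrite last_cat.
- by rewrite -cat_cons all_cat ar.
Qed.

Lemma reach_edge e a u v : e u v -> a u -> a v -> reach e a u v.
Proof. by move=> uv au av; exists [:: v]; rewrite /= uv au av. Qed.

Lemma reach_sym e a u v : symmetric e -> reach e a u v -> reach e a v u.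
Proof.
move=> se [r [er <- ar]]; exists (rev (belast u r)); split.
- by rewrite rev_path; under eq_path do rewrite se.
- by case: r {er ar} => //= w r; rewrite rev_cons last_rcons.
- rewrite -rev_rcons -lastI all_rev//.
Qed.

(* Two distinct neighbours of [p] joined by a path that avoids [p] close up to
   a cycle through [p]. *)
Lemma acyclic_separates e p u v : symmetric e -> graph_acyclic e ->
  e p u -> e p v -> u != v -> ~ reach e (predC1 p) u v.
Proof.
move=> se ace pu pv uv [r [er rv ar]]; move: pv uv; rewrite -rv.
case/shortenP: er => s es us sr pv uv.
apply: (ace [:: p, u & s]).
  by case: s {es us sr} uv pv => //=; rewrite eqxx.
rewrite /ucycle /= pu rcons_path es se pv /=.
move: ar us => /= /andP[up ar] -> /=; rewrite !inE eq_sym negb_or up andbT /=.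
by apply/negP => /sr /(allP ar); rewrite /= eqxx.
Qed.

End Reachability.

(** * Connectedness and cycles of the intersection graph *)

Section Systems.
Context {R : realType} {X : metricType R} {m : nat}.
Variables (S : 'I_m -> X -> X) (K : set X).
Hypothesis S_contr : forall i, metric_contraction (S i).
Hypothesis K_attr : is_attractor S K.
Hypothesis S_fip : finite_intersection_property S K.

Local Notation K_ := (piece S K).
Local Notation P := (common_points S K).
Local Notation Gamma := (intersection_graph S K).

Lemma common_ratio : exists q, [/\ 0 <= q, q < 1 &
  forall i x y, mdist (S i x) (S i y) <= q * mdist x y].
Proof.
have /choice[q qP] := S_contr.
exists (\big[Num.max/0]_i q i); split.
- by apply: (big_ind (fun r => 0 <= r)) => // [r s ? ?|i _];
    [rewrite le_max; apply/orP; left|have [] := qP i].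
- by apply: bigmax_lt => // i _; have [] := qP i.
- move=> i x y; have [_ _ /(_ x y)] := qP i; move=> /le_trans; apply.
  by rewrite ler_wpM2r ?mdist_ge0// le_bigmax.
Qed.

Lemma contraction_ucont i (f : R -> X) : ucont f -> ucont (S i \o f).
Proof.
have [q [q0 q1 Sq]] := S_contr i.
move=> uf e /uf[d d0 H]; exists d => // s t /H; apply: le_lt_trans.
by rewrite (le_trans (Sq _ _))// ler_piMl ?mdist_ge0// ltW.
Qed.

Lemma contraction_continuous i : continuous (S i).
Proof.
have [q [q0 q1 Sq]] := S_contr i.
move=> x; apply/metricType_numDomainType.cvgrPdist_lt => e e0.
near=> y; apply: (@le_lt_trans _ _ (mdist x y)).
  by rewrite (le_trans (Sq _ _))// ler_piMl ?mdist_ge0// ltW.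
by near: y; apply: metricType_numDomainType.cvgr_dist_lt => //; exact: cvg_id.
Unshelve. all: by end_near. Qed.

Lemma attractor_compact : compact K. Proof. by case: K_attr. Qed.

Lemma piece_sub i : K_ i `<=` K.
Proof. by case: K_attr => _ _ {2}-> x Kx; exists i. Qed.

Lemma attractor_cover x : K x -> exists i, K_ i x.
Proof. by case: K_attr => _ _ {1}-> [i _ Kx]; exists i. Qed.

Lemma piece_nonempty i : K_ i !=set0.
Proof. by case: K_attr => -[x Kx] _ _; exists (S i x); exists x. Qed.

Lemma piece_closed i : closed (K_ i).
Proof.
apply: compact_closed; first exact: metric_hausdorff.
apply: continuous_compact attractor_compact; apply: continuous_subspaceT.
exact: contraction_continuous.
Qed.

Lemma pieces_closed (T : set 'I_m) : closed (\bigcup_(i in T) K_ i).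
Proof. by apply: closed_bigcup => [|i _]; [exact: finite_finset|exact: piece_closed]. Qed.

Lemma finite_common_points : finite_set P.
Proof.
have -> : P = \bigcup_(ij in [set ij : 'I_m * 'I_m | ij.1 != ij.2])
    (K_ ij.1 `&` K_ ij.2).
  by apply/seteqP; split => [x [i [j [ij xi xj]]]|x [[i j] /= ij [xi xj]]];
    [exists (i, j)|exists i, j].
by apply: bigcup_finite => [|[i j] /= ij]; [exact: finite_finset|exact: S_fip].
Qed.

Lemma intersection_graph_sym : symmetric Gamma.
Proof. by case=> [i|p] [j|r]. Qed.

Lemma intersection_graphP i (p : P) : reflect (K_ i (\val p)) (Gamma (inl i) (inr p)).
Proof. by apply: (iffP idP) => [/set_mem|/mem_set]. Qed.

Lemma exists_black x i j : i != j -> K_ i x -> K_ j x ->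
  exists p : P, \val p = x.
Proof.
move=> ij xi xj; have Px : P x by exists i, j.
by exists (exist _ x (mem_set Px)).
Qed.

Lemma neighbour (p : P) : exists i, Gamma (inl i) (inr p).
Proof.
case: p => x Px; have [i [j [_ xi _]]] := set_mem Px.
by exists i; exact/intersection_graphP.
Qed.

Lemma neighbour_neq (p : P) i : exists2 j, j != i & Gamma (inl j) (inr p).
Proof.
case: p => x Px; have [j [k [jk xj xk]]] := set_mem Px.
have [ji|ji] := eqVneq j i; last by exists j => //; exact/intersection_graphP.
by exists k; [rewrite -ji eq_sym|exact/intersection_graphP].
Qed.

(** On [C], the pieces indexed by [T] and the remaining ones form two disjoint closed sets covering
    [C]; the first meets [C], so it contains [C]. *)
Lemma connected_pieces (T : set 'I_m) (C : set X) x y i j :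
  connected C -> C `<=` K ->
  (forall z k l, C z -> T k -> ~ T l -> K_ k z -> K_ l z -> False) ->
  C x -> C y -> T i -> K_ i x -> K_ j y -> T j.
Proof.
move=> cC CK CT Cx Cy Ti xi yj.
suff CTE : C `&` \bigcup_(k in T) K_ k = C.
  apply: contrapT => nTj; have : C y := Cy; rewrite -CTE => -[_ [k Tk yk]].
  exact: (CT y k j).
apply: cC.
- by exists x; split => //; exists i.
- exists (~` \bigcup_(k in ~` T) K_ k); first exact/closed_openC/pieces_closed.
  apply/seteqP; split => z [Cz].
    by move=> [k Tk zk]; split => // -[l nTl zl]; exact: (CT z k l).
  move=> nz; split => //; have [k zk] := attractor_cover (CK _ Cz).
  by exists k => //; apply: contrapT => nTk; apply: nz; exists k.
- by exists (\bigcup_(k in T) K_ k) => //; exact: pieces_closed.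
Qed.

(** Pieces of distinct indices meeting at [z] are both adjacent to the black vertex [z], which [a]
    admits. *)
Lemma reach_common (a : pred ('I_m + P)) u i j z :
  reach Gamma a u (inl i) -> K_ i z -> K_ j z -> a (inl j) ->
  (forall p : P, \val p = z -> a (inr p)) -> reach Gamma a u (inl j).
Proof.
move=> ui zi zj aj az; have [<-//|ij] := eqVneq i j.
have [p pz] := exists_black ij zi zj.
have ai : a (inl i).
  by case: ui => r [_ <-]; case/lastP: r => [/=|r w]; [case/andP|
    rewrite last_rcons -cats1 -cat_cons all_cat /= andbT => /andP[]].
apply: reach_trans ui _; apply: (@reach_trans _ _ _ _ (inr p)).
  by apply: reach_edge => //; [apply/intersection_graphP; rewrite pz|exact: az].
apply: reach_edge => //; last exact: az.
by rewrite intersection_graph_sym; apply/intersection_graphP; rewrite pz.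
Qed.

(** Pieces reachable from [inl i] share no point with the other pieces, since such a point would be
    a black vertex joining them. *)
Lemma connected_graph : connected K -> graph_connected Gamma.
Proof.
move=> cK.
have white i j : reach Gamma predT (inl i) (inl j).
  have [x xi] := piece_nonempty i; have [y yj] := piece_nonempty j.
  apply: (@connected_pieces (fun k => reach Gamma predT (inl i) (inl k))
    K x y i j) => //.
  - move=> z k l _ ik il zk zl; apply: il; exact: reach_common ik zk zl _ _.
  - exact: piece_sub xi.
  - exact: piece_sub yj.
  - exact: reach_refl.
have to_white u i : reach Gamma predT u (inl i).
  case: u => [j|p] //; have [j jp] := neighbour p.
  by apply: reach_trans (white j i); apply: reach_edge.
have [x [i _]] : exists x i, K_ i x.
  by case: K_attr => -[x /attractor_cover[i xi]] _ _; exists x, i.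
move=> u v; have [r [er rv _]] : reach Gamma predT u v; last by exists r.
apply: reach_trans (to_white u i) _.
by apply: reach_sym; [exact: intersection_graph_sym|exact: to_white].
Qed.

(** Lets a path of the graph be followed in [K]: crossing an edge moves a point inside one piece. *)
Definition point_set (u : 'I_m + P) : set X :=
  match u with inl i => K_ i | inr p => [set \val p] end.

(** The last clause tells that the piece carrying the move is an end of the edge; a path avoiding
    [inl i0] thus never moves inside the piece of [i0] as such. *)
Lemma point_set_edge u v x : Gamma u v -> point_set u x ->
  exists2 y, point_set v y & (exists i, [/\ K_ i x, K_ i y &
    inl i = u \/ inl i = v]).
Proof.
case: u v => [i|p] [j|r] //= uv.
  move=> xi; exists (\val r) => //; exists i; split => //; last by left.
  exact: set_mem uv.
move=> ->; exists (\val p) => //; first exact: set_mem uv.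
by exists j; split => //; [exact: set_mem uv|exact: set_mem uv|right].
Qed.

Lemma point_set_end u x y : point_set u x -> point_set u y ->
  exists i, K_ i x /\ K_ i y /\ (forall j, u = inl j -> i = j).
Proof.
case: u => [i|p] /=; first by move=> *; exists i; split => //; split => // j [].
move=> -> ->; have [i ip] := neighbour p.
by exists i; split; [exact: set_mem ip|split => //; exact: set_mem ip].
Qed.

(** One link for each edge, and one more inside the last vertex. *)
Lemma path_chain u r x y : path Gamma u r -> point_set u x ->
  point_set (last u r) y -> chain S K (size r).+1 x y.
Proof.
elim: r u x => [|v r IH] u x /=.
  by move=> _ ux uy; have [i [? [? _]]] := point_set_end ux uy; exists y => //; exists i.
move=> /andP[uv vr] ux ry; have [z vz [i [xi zi _]]] := point_set_edge uv ux.
by exists z; [exists i|exact: IH vr vz ry].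
Qed.

Lemma graph_joined : graph_connected Gamma ->
  forall x y, K x -> K y -> joined K x y.
Proof.
move=> gc.
have [q [q0 q1 Sq]] := common_ratio.
have [D _ KD] := compact_mdist_bounded attractor_compact.
(* The length depends only on the pair of pieces, and there are finitely many pairs. *)
have /choice[N HN] : forall ij : 'I_m * 'I_m, exists n, forall x y,
    K_ ij.1 x -> K_ ij.2 y -> chain S K n x y.
  move=> [i j]; have [r er rj] := gc (inl i) (inl j).
  by exists (size r).+1 => x y xi yj; apply: path_chain er _ _ => //; rewrite rj.
(* Trivial links from [x] to itself pad shorter chains to the common length. *)
have chain_add n k x y : K x -> chain S K n x y -> chain S K (k + n) x y.
  move=> Kx xy; elim: k => [//|k IH]; rewrite addSn; exists x => //.
  by have [i xi] := attractor_cover Kx; exists i.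
apply: (@chain_joined _ _ _ S K q D _ Sq q0 q1 KD attractor_compact (\max_ij N ij)).
  by move=> i x Kx; apply: (@piece_sub i); exists x.
move=> x y Kx Ky; have [i xi] := attractor_cover Kx; have [j yj] := attractor_cover Ky.
have NM : (N (i, j) <= (\max_ij N ij).+2)%N.
  by rewrite (leq_trans (leq_bigmax (i, j)))// leqW.
by rewrite -(subnK NM); apply: chain_add => //; exact: HN.
Qed.

Lemma piece_joined i x y : (forall x y, K x -> K y -> joined K x y) ->
  K_ i x -> K_ i y -> joined (K_ i) x y.
Proof.
move=> KJ [a Ka <-] [b Kb <-]; have [f [uf f0 f1 fK]] := KJ _ _ Ka Kb.
exists (S i \o f); split; rewrite /= ?f0 ?f1//; first exact: contraction_ucont.
by move=> t; exists (f t).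
Qed.

Lemma path_joined i0 u r x y : (forall x y, K x -> K y -> joined K x y) ->
  path Gamma u r -> inl i0 \notin u :: r -> point_set u x ->
  point_set (last u r) y -> joined (\bigcup_(i in [set i | i != i0]) K_ i) x y.
Proof.
move=> KJ.
have joinS i z w : i != i0 -> K_ i z -> K_ i w ->
    joined (\bigcup_(i in [set i | i != i0]) K_ i) z w.
  move=> ii0 zi wi; apply: joinedS (piece_joined KJ zi wi) => v vi.
  by exists i.
elim: r u x => [|v r IH] u x /=.
  move=> _; rewrite inE => ui0; case: u ui0 => [i|p] /=.
    by move=> ii0; apply: joinS; apply: contraNneq ii0 => ->.
  (* A final black vertex lies in some piece of index other than [i0]. *)
  move=> _ -> ->; have [j ji0 jp] := neighbour_neq p i0.
  by apply: (joinS j) => //; exact: set_mem jp.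
move=> /andP[uv vr]; rewrite inE negb_or => /andP[ui0 vri0] ux ry.
have [z vz [i [xi zi iuv]]] := point_set_edge uv ux.
apply: joined_trans (IH v z vr vri0 vz ry).
apply: (joinS i) => //; apply/eqP => ii0.
by case: iuv => iE; [move: ui0|move: vri0]; rewrite -iE ii0 ?inE eqxx.
Qed.

Lemma dendrite_acyclic : connected K ->
  (~ exists2 C, simple_closed_curve C & C `<=` K) -> graph_acyclic Gamma.
Proof.
move=> cK noscc c c2 cyc.
have KJ := graph_joined (connected_graph cK).
(* Two white vertices are never adjacent, so one of the first two vertices is black. *)
have [p pc] : exists p : P, inr p \in c.
  move: c2 cyc; case: c => [//|[i|p] c] c2; last by exists p; rewrite inE eqxx.
  move: c2; case: c => [//|[j|r] c] _; first by rewrite /ucycle /=.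
  by exists r; rewrite !inE eqxx orbT.
case: (rot_to pc) => n s Es.
have : ucycle Gamma (inr p :: s) by rewrite -Es rot_ucycle.
have : (2 < size (inr p :: s))%N by rewrite -Es size_rot.
(* Colours alternate, so the rotated cycle starts with [p], [i0], [p1]. *)
case: s {Es} => [|[i0|?] [|[?|p1] s]]//= _; rewrite /ucycle /= ?andbF//.
move=> /andP[/and3P[pi0 i0p1 p1s]].
rewrite !inE !negb_or -!andbA => /and5P[_ pp1 ps i0p1' /andP[i0s _]].
pose B := \bigcup_(i in [set i | i != i0]) K_ i.
have J1 : joined (K_ i0) (\val p1) (\val p).
  by apply: piece_joined KJ _ _; [exact: set_mem i0p1|exact: set_mem pi0].
have J2 : joined B (\val p1) (\val p).
  apply: (path_joined KJ p1s) => //; last by rewrite last_rcons.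
  by rewrite inE mem_rcons inE !negb_or i0s.
have p1p : \val p1 <> \val p.
  by move=> /val_inj p1p; move: pp1; rewrite p1p eqxx.
have cpt (T : set X) : closed T -> T `<=` K -> compact T.
  by move=> cT TK; exact: subclosed_compact cT attractor_compact TK.
have A1 := joined_simple_arc (cpt _ (@piece_closed i0) (@piece_sub i0)) J1 p1p.
have BK : B `<=` K by move=> x [i _]; exact: piece_sub.
have A2 := joined_simple_arc (cpt _ (@pieces_closed _) BK) J2 p1p.
have [|C sC CAB] := glue_arcs A1 A2.
  (* A point of [K_ i0] lying in a piece of another index belongs to [P]. *)
  apply: sub_finite_set finite_common_points => x [xi0 [j ji0 xj]].
  by exists j, i0.
apply: noscc; exists C => // x /CAB[|]; [exact: piece_sub|exact: BK].
Qed.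

End Systems.

(** * Dendrites *)

Section Dendrite.
Context {R : realType} {X : metricType R} {m : nat}.
Variables (S : 'I_m -> X -> X) (K : set X).
Hypothesis S_inj : forall i, injective (S i).
Hypothesis S_contr : forall i, metric_contraction (S i).
Hypothesis K_attr : is_attractor S K.
Hypothesis S_fip : finite_intersection_property S K.

Local Notation K_ := (piece S K).
Local Notation P := (common_points S K).
Local Notation Gamma := (intersection_graph S K).

(** The sets [S_w (K)] for the words [w] of length [n]. *)
Fixpoint cells n : set (set X) :=
  if n is n'.+1 then [set S ic.1 @` ic.2 | ic in setT `*` cells n'] else [set K].

Lemma cells_finite n : finite_set (cells n).
Proof.
elim: n => [|n IH]; first exact: finite_set1.
by apply: finite_image; apply: finite_setX => //; exact: finite_finset.
Qed.

Lemma cells_compact n c : cells n c -> compact c.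
Proof.
elim: n c => [|n IH] c /=; first by move=> ->; exact: (attractor_compact K_attr).
move=> [[i d] [_ /= dn] <-]; apply: continuous_compact (IH _ dn).
by apply: continuous_subspaceT; exact: (contraction_continuous S_contr).
Qed.

Lemma cells_connected n c : connected K -> cells n c -> connected c.
Proof.
move=> cK; elim: n c => [|n IH] c /=; first by move=> ->.
move=> [[i d] [_ /= dn] <-]; apply: connected_continuous_connected (IH _ dn) _.
by apply: continuous_subspaceT; exact: (contraction_continuous S_contr).
Qed.

Lemma cells_sub n c : cells n c -> c `<=` K.
Proof.
elim: n c => [|n IH] c /=; first by move=> ->.
move=> [[i d] [_ /= dn] <-] _ [x dx <-]; apply: (piece_sub K_attr (i := i)).
by exists x => //; exact: IH dx.
Qed.

Lemma cells_cover n x : K x -> exists2 c, cells n c & c x.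
Proof.
elim: n x => [|n IH] x Kx; first by exists K.
have [i [y Ky <-]] := attractor_cover K_attr Kx; have [c cn cy] := IH y Ky.
by exists (S i @` c); [exists (i, c)|exists y].
Qed.

Lemma cells_diam n c q D x y : 0 <= q ->
  (forall i x y, mdist (S i x) (S i y) <= q * mdist x y) ->
  (forall x y, K x -> K y -> mdist x y <= D) ->
  cells n c -> c x -> c y -> mdist x y <= q ^+ n * D.
Proof.
move=> q0 Sq KD; elim: n c x y => [|n IH] c x y /=.
  by move=> ->; rewrite expr0 mul1r; exact: KD.
move=> [[i d] [_ /= dn] <-] [a da <-] [b db <-].
rewrite (le_trans (Sq _ _ _))// exprS -mulrA ler_wpM2l//; exact: IH da db.
Qed.

(** Small cells through a point [y] of the component [V] lie in [U] and are connected, hence lie in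
    [V]; this makes [V] open in [K]. *)
Lemma attractor_locally_connected : connected K -> locally_connected K.
Proof.
move=> cK x U Kx oU Ux.
have [q [q0 q1 Sq]] := common_ratio S_contr.
have [D _ KD] := compact_mdist_bounded (attractor_compact K_attr).
pose V := connected_component (K `&` U) x.
exists V; split.
- by apply: connected_component_refl.
- by move=> y /connected_component_sub[].
- exact: component_connected.
exists (\bigcup_(W in [set W | open W /\ K `&` W `<=` V]) W).
  by apply: bigcup_open => W [].
apply/seteqP; split => y; last by move=> [Ky [W [_ KWV] Wy]]; exact: KWV.
move=> Vy; have [Ky Uy] := connected_component_sub Vy; split => //.
have [e /= e0 eU] : exists2 e, 0 < e & forall z, mdist y z < e -> U z.
  have : nbhs y U by exact: open_nbhs_nbhs.
  by rewrite -metricType_numDomainType.filter_from_mdist_nbhs => -[e e0 H]; exists e.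
have [n qn] := expr_small D q0 q1 e0.
(* Deleting the finitely many level [n] cells that miss [y] leaves an open set in which every point
   of [K] shares a cell with [y]. *)
exists (~` \bigcup_(c in [set c | cells n c /\ ~ c y]) c); last by move=> [c [_ ncy]].
split.
  apply/closed_openC/closed_bigcup.
    by apply: sub_finite_set (cells_finite n) => c [].
  move=> c [cn _]; apply: compact_closed (cells_compact cn).
  exact: metric_hausdorff.
move=> z [Kz nz]; have [c cn cz] := cells_cover n Kz.
have cy : c y by apply: contrapT => ncy; apply: nz; exists c.
rewrite /V (same_connected_component Vy).
apply: (connected_component_max cy) cz; last exact: cells_connected cn.
move=> w cw; split; first exact: cells_sub cn w cw.
by apply: eU; rewrite (le_lt_trans _ qn)//; exact: cells_diam cn cy cw.
Qed.

Lemma curve_in_piece C : tree Gamma -> simple_closed_curve C -> C `<=` K ->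
  exists i, C `<=` K_ i.
Proof.
move=> [gc ga] sC CK.
have sym := @intersection_graph_sym _ _ _ S K.
have Pfin := finite_common_points S_fip.
have iC := simple_closed_curve_infinite sC.
have [x Cx nPx] : exists2 x, C x & ~ P x.
  apply: contrapT => H; apply: iC; apply: sub_finite_set Pfin => x Cx.
  by apply: contrapT => nPx; apply: H; exists x.
have [i xi] := attractor_cover K_attr (CK _ Cx).
(* This makes [C] minus [K_ i] finite. Being open in [C], it would be all of [C] if nonempty, yet
   [x] lies in [K_ i]. *)
suff key y : C y -> ~ K_ i y -> P y.
  exists i => y Cy; apply: contrapT => niy.
  suff /(_ x Cx) : C `<=` ~` K_ i by apply.
  apply: connected_open_finite (simple_closed_curve_connected sC) _ _ _.
  - by apply: closed_openC; exact: (piece_closed S_contr K_attr).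
  - by exists y.
  - by apply: sub_finite_set Pfin => z [Cz niz]; exact: key.
move=> Cy niy; apply: contrapT => nPy.
have [j yj] := attractor_cover K_attr (CK _ Cy).
have ij : i != j by apply/eqP => ij; apply: niy; rewrite ij.
have [r er rj] := gc (inl i) (inl j).
(* A simple path from [i] to [j] starts with [i], [p], [k] and never returns to [p]. *)
move: rj; case/shortenP: er => -[|[l|p] s] //=.
  by move=> _ _ _ [ijE]; rewrite ijE eqxx in ij.
case: s => [//|[k|l] s] /=; last by rewrite !andbF.
move=> /and3P[ip pk ks] + _ sj.
rewrite !inE !negb_or -!andbA => /and4P[_ ik _ /andP[_ /andP[ps _]]].
(* The rest of the path joins [k] to [j] without [p]; joining [i] to [j] without [p] would connect
   two distinct neighbours of [p] off [p]. *)
have nTj : ~ reach Gamma (predC1 (inr p)) (inl i) (inl j).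
  move=> Tj; apply: (acyclic_separates sym ga (p := inr p) _ _ ik) => //.
  apply: reach_trans Tj _; apply: reach_sym => //.
  exists s; split => //=; apply/allP => v vs /=.
  by apply: contraNneq ps => <-.
have Pp : P (\val p) by exact: set_valP.
apply: nTj.
(* [C] minus [p] is connected, and distinct pieces meet on it only at black vertices other than [p];
   so [j] would be reachable from [i] without [p]. *)
apply: (@connected_pieces _ _ _ S K S_contr K_attr
  (fun l => reach Gamma (predC1 (inr p)) (inl i) (inl l)) (C `\ \val p) x y i j) => //.
- exact: simple_closed_curve_setD1.
- by move=> z [/CK].
- move=> z l l' [_ zp] il il' zl zl'; apply: il'.
  apply: (reach_common il zl zl') => // p' p'z /=.
  by apply/eqP => -[pE]; apply: zp; rewrite -p'z pE.
- by split => // xp; apply: nPx; rewrite xp.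
- by split => // yp; apply: nPy; rewrite yp.
- exact: reach_refl.
Qed.

Lemma no_simple_closed_curve : tree Gamma ->
  ~ exists2 C, simple_closed_curve C & C `<=` K.
Proof.
move=> tG [C sC CK].
have [q [q0 q1 Sq]] := common_ratio S_contr.
have [D _ KD] := compact_mdist_bounded (attractor_compact K_attr).
(* All curves are treated at once, as the induction replaces [C] by its preimage under some
   [S i]. *)
have small n : forall C, simple_closed_curve C -> C `<=` K ->
    forall x y, C x -> C y -> mdist x y <= q ^+ n * D.
  elim: n => [|n IH] {}C {}sC {}CK x y Cx Cy.
    by rewrite expr0 mul1r; apply: KD; exact: CK.
  have [i Ci] := curve_in_piece tG sC CK.
  have [C' sC' [C'K CE]] := simple_closed_curve_preimage (attractor_compact K_attr)
    (@contraction_continuous _ _ _ _ S_contr i) (@S_inj i) sC Ci.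
  move: Cx Cy; rewrite CE => -[a C'a <-] [b C'b <-].
  by rewrite (le_trans (Sq _ _ _))// exprS -mulrA ler_wpM2l//; exact: IH C'K _ _ _ _.
have [x [y [Cx Cy xy]]] := simple_closed_curve_ex2 sC.
have xy0 : 0 < mdist x y by rewrite mdist_gt0; apply/eqP.
have [n] := expr_small D q0 q1 xy0.
by rewrite ltNge (small n C).
Qed.

Lemma dendrite_tree : dendrite K <-> tree Gamma.
Proof.
split=> [[_ _ cK _ noscc]|tG].
  split; first exact: connected_graph.
  exact: dendrite_acyclic.
have cK : connected K.
  apply: joined_connected; apply: graph_joined => //; exact: tG.1.
have [K0 cptK _] := K_attr.
by split => //; [exact: attractor_locally_connected|exact: no_simple_closed_curve].
Qed.

End Dendrite.

Theorem theorem2p6 (R : realType) (X : completeMetricType R) (m : nat)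
    (S : 'I_m -> X -> X) (K : set X)
    (S_inj : forall i, injective (S i))
    (S_contr : forall i, metric_contraction (S i))
    (K_attr : is_attractor S K)
    (S_fip : finite_intersection_property S K) :
  dendrite K <-> tree (intersection_graph S K).
Proof. exact: dendrite_tree. Qed.
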